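(* Let $L, M$ be two full-rank lattices in $\mathbb{R}^d$ such that $\mathrm{vol}(L) < \mathrm{vol}(M)$. Then there exists a bounded measurable set $F \subseteq \mathbb{R}^d$ that tiles $\mathbb{R}^d$ by translations with $L$ and packs $\mathbb{R}^d$ by translations with $M$.
   Context: A lattice in $\mathbb{R}^d$ is a discrete subgroup of $\mathbb{R}^d$; it is full-rank if it spans $\mathbb{R}^d$ over $\mathbb{R}$, equivalently if it equals $A\mathbb{Z}^d$ for some nonsingular real $d\times d$ matrix $A$. The volume of $L = A\mathbb{Z}^d$ is $\mathrm{vol}(L) = |\det A|$, i.e. the volume of the fundamental parallelepiped $A[0,1)^d$ (independent of the choice of $A$). Measurable means Lebesgue measurable. For a measurable set $\Omega\subseteq\mathbb{R}^d$ and a discrete set $T\subseteq\mathbb{R}^d$, $\Omega$ packs $\mathbb{R}^d$ by translations with $T$ if $\sum_{t\in T}\mathbf{1}_\Omega(x+t)\le 1$ for almost every $x\in\mathbb{R}^d$, and $\Omega$ tiles $\mathbb{R}^d$ by translations with $T$ if $\sum_{t\in T}\mathbf{1}_\Omega(x+t) = 1$ for almost every $x\in\mathbb{R}^d$, where $\mathbf{1}_\Omega$ is the indicator function of $\Omega$. *)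

(* Defs.v *)
From HB Require Import structures.
From mathcomp Require Import all_boot all_order all_algebra.
From mathcomp Require Import all_classical all_reals all_analysis.

Set Implicit Arguments.
Unset Strict Implicit.
Unset Printing Implicit Defensive.

Import Order.TTheory GRing.Theory Num.Theory.
Import numFieldNormedType.Exports.

Local Open Scope classical_set_scope.
Local Open Scope ring_scope.

(* Points of R^d are column vectors 'cV[R]_d. The norm that MathComp-Analysis
   puts on them is the sup norm; it has the bounded sets and the topology of
   the Euclidean norm. *)

Section lebesgue.
Variables (R : realType) (d : nat).

(* A pair (a, b) stands for the box \prod_i ]a_i, b_i], which is empty as soon
   as b_i <= a_i for some i. *)
Definition box (ab : 'cV[R]_d * 'cV[R]_d) : set 'cV[R]_d :=
  [set x | forall i, ab.1 i 0 < x i 0 <= ab.2 i 0].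

Definition box_volume (ab : 'cV[R]_d * 'cV[R]_d) : R :=
  \prod_i Num.max 0 (ab.2 i 0 - ab.1 i 0).

Local Open Scope ereal_scope.

(* Covers are countable sets of boxes, rather than sequences, so that the empty
   cover is allowed; it is needed only to give set0 measure 0 when d = 0. *)
Definition lebesgue_outer (X : set 'cV[R]_d) : \bar R :=
  ereal_inf [set \esum_(ab in C) (box_volume ab)%:E | C in
    [set C | countable C /\ X `<=` \bigcup_(ab in C) box ab]].

Lemma box_volume_ge0 ab : 0 <= (box_volume ab)%:E.
Proof. by rewrite lee_fin; apply: prodr_ge0 => i _; rewrite le_max lexx. Qed.

Lemma lebesgue_outer_ge0 X : 0 <= lebesgue_outer X.
Proof.
apply: le_ereal_inf_tmp => _ [C _ <-].
by apply: esum_ge0 => ab _; exact: box_volume_ge0.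
Qed.

Lemma lebesgue_outer0 : lebesgue_outer set0 = 0.
Proof.
apply/eqP; rewrite eq_le lebesgue_outer_ge0 andbT.
by apply: ereal_inf_lbound; exists set0; [split|rewrite esum_set0].
Qed.

Lemma le_lebesgue_outer : {homo lebesgue_outer : A B / A `<=` B >-> A <= B}.
Proof.
move=> A B AB; apply: ereal_inf_le_tmp => _ [C [cC BC] <-].
by exists C => //; split => //; exact: subset_trans BC.
Qed.

Lemma lebesgue_outer_sigma_subadditive : sigma_subadditive lebesgue_outer.
Proof.
move=> A; have [[i ioo]|] := pselect (exists i, lebesgue_outer (A i) = +oo).
  rewrite (eseries_pinfty _ _ ioo) ?leey// => n _.
  by rewrite -ltNye (lt_le_trans _ (lebesgue_outer_ge0 _)).
rewrite -forallNE => Aoo.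
apply/lee_addgt0Pr => e e0.
apply: le_trans (epsilon_trick _ _ (ltW e0)); last first.
  by move=> n; exact: lebesgue_outer_ge0.
pose P n G := [/\ countable G, A n `<=` \bigcup_(ab in G) box ab &
  \esum_(ab in G) (box_volume ab)%:E <=
    lebesgue_outer (A n) + (e / (2 ^ n.+1)%:R)%:E].
have [G PG] : {G & forall n, P n (G n)}.
  apply: (@choice _ _ P) => n.
  have en0 : (0 < e / (2 ^ n.+1)%:R)%R by rewrite divr_gt0.
  have Afin : lebesgue_outer (A n) \is a fin_num.
    by rewrite ge0_fin_numE ?lebesgue_outer_ge0// ltey; exact/eqP/Aoo.
  have [_ [C [cC AC] <-] Clt] := lb_ereal_inf_adherent en0 Afin.
  by exists C; split => //; exact: ltW.
have GS n : seqDU G n `<=` G n by exact: subset_seqDU.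
apply: (@le_trans _ _ (\esum_(ab in \bigcup_n G n) (box_volume ab)%:E)).
  apply: ereal_inf_lbound; exists (\bigcup_n G n) => //; split.
    by apply: bigcup_countable => // n _; have [] := PG n.
  move=> x [n _ Anx]; have [_ /(_ _ Anx)[ab Gab xab] _] := PG n.
  by exists ab => //; exists n.
rewrite seqDU_bigcup_eq nneseries_sum_bigcup//; last exact: box_volume_ge0.
apply: lee_nneseries => [n _ _|n _].
  by apply: esum_ge0 => ab _; exact: box_volume_ge0.
have [_ _ +] := PG n; apply: le_trans.
rewrite esum_mkcond [leRHS]esum_mkcond; apply: le_esum => ab _.
case: ifPn => [/set_mem/GS/mem_set->//|_].
by case: ifPn => // _; exact: box_volume_ge0.
Qed.

HB.instance Definition _ := isOuterMeasure.Build R 'cV[R]_d lebesgue_outer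
  lebesgue_outer0 lebesgue_outer_ge0 le_lebesgue_outer
  lebesgue_outer_sigma_subadditive.

(* R^d with the sigma-algebra of Lebesgue measurable sets, namely the sets that
   are Caratheodory measurable for the Lebesgue outer measure. *)
Definition lebesgue_space := caratheodory_type lebesgue_outer.

HB.instance Definition _ := Measurable.on lebesgue_space.

Definition lebesgue : set lebesgue_space -> \bar R := lebesgue_outer.

HB.instance Definition _ := isMeasure.Build _ lebesgue_space R lebesgue
  (@caratheodory_measure0 _ _ lebesgue_outer)
  (@caratheodory_measure_ge0 _ _ lebesgue_outer)
  (@caratheodory_measure_sigma_additive _ _ lebesgue_outer).

End lebesgue.

Arguments lebesgue_space : clear implicits.
Arguments lebesgue : clear implicits.

Section lattices.
Variables (R : realType) (d : nat).
Implicit Types (L T Omega : set 'cV[R]_d) (A : 'M[R]_d).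

Definition lattice L :=
  [/\ L 0, forall x y, L x -> L y -> L (x - y) & L `<=` isolated L].

Definition full_rank L :=
  forall v, exists2 X : seq 'cV[R]_d, [set` X] `<=` L & v \in <<X>>%VS.

Definition lattice_of A : set 'cV[R]_d :=
  range (fun z : 'cV[int]_d => A *m map_mx intr z).

(* The value |det A| does not depend on the nonsingular A with L = A Z^d; the
   default value 0 is never taken at a full-rank lattice. *)
Definition vol L : R :=
  xget 0 [set v | exists A, [/\ A \in unitmx, L = lattice_of A & v = `|\det A|]].

Definition multiplicity Omega T (x : 'cV[R]_d) : \bar R :=
  \esum_(t in T) (\1_Omega (x + t))%:E.

Definition packs Omega T :=
  {ae lebesgue R d, forall x, (multiplicity Omega T x <= 1)%E}.

Definition tiles Omega T :=
  {ae lebesgue R d, forall x, multiplicity Omega T x = 1%E}.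

End lattices.

(* Main.v *)
Require Import Defs.
From mathcomp Require Import all_boot all_order all_algebra.
From mathcomp Require Import all_classical all_reals all_analysis.
From mathcomp Require Import perm measurable_realfun ring lra zify.
Import Order.TTheory GRing.Theory Num.Theory.
Import numFieldNormedType.Exports.
Local Open Scope classical_set_scope.
Local Open Scope ring_scope.

Set Implicit Arguments.
Unset Strict Implicit.
Unset Printing Implicit Defensive.

(* In suitable coordinates the closure of L + M is the group H of the points whose
   coordinates in J are integers. Write L = A Z^d and M = B Z^d; the J-rows of A and
   B are integral and |det A| < |det B|. Blow up the coordinates outside J by a
   large factor v for A, by a slightly smaller one t v for B, and round A and B
   to integer matrices A' and B'. The map A A'^-1 carries the unit cubes (flat in the
   J-directions) at representatives of Z^d / A' Z^d to |det A'| cells of H that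
   together represent H/L.
   In the same way B' gives |det B'| slots that represent H/M. For v large there
   are at least as many slots as cells, and every cell, moved by a suitable element
   of H, fits into any given slot with room to spare. As L + M is dense in H, the move
   can be made by an element of L + M. Assign the cells to distinct slots and let
   F consist of the cells, each moved by the L-component of its move, thickened by
   [0, 1[ in the J-coordinates. Finitely many cells are moved, so F is bounded;
   being moved along L they still tile with L, and as they lie in distinct slots
   modulo M, they pack with M. *)

(** * Norms, and determinants of column replacements *)

Section matrix_norm.
Variables (R : realType) (d : nat).
Implicit Types (x y : 'cV[R]_d) (P : 'M[R]_d).

Lemma ler_entry_norm x i : `|x i 0| <= `|x|.
Proof.
rewrite [leRHS]/Num.Def.normr /= mx_normrE.
by apply/bigmax_geP; right => /=; exists (i, 0).
Qed.

Lemma norm_lt_entries x e : 0 < e -> (forall i, `|x i 0| < e) -> `|x| < e.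
Proof.
move=> e0 xe; rewrite /Num.Def.normr /= mx_normrE.
by apply/bigmax_ltP; split => // -[i j] _ /=; rewrite (ord1 j).
Qed.

Lemma norm_le_entries x e : 0 <= e -> (forall i, `|x i 0| <= e) -> `|x| <= e.
Proof.
move=> e0 xe; rewrite /Num.Def.normr /= mx_normrE.
by apply/bigmax_leP; split => // -[i j] _ /=; rewrite (ord1 j).
Qed.

Lemma norm_trmx x : `|x^T| = `|x|.
Proof.
rewrite /Num.Def.normr /= !mx_normrE.
rewrite (reindex (fun p : 'I_d * 'I_1 => (p.2, p.1)))/=; last first.
  by exists (fun p => (p.2, p.1)) => -[].
by apply: eq_bigr => -[i j] _; rewrite mxE.
Qed.

Lemma mulmx_norm_bound P : exists2 C, 0 < C & forall x, `|P *m x| <= C * `|x|.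
Proof.
exists (1 + \sum_i \sum_j `|P i j|) => [|x].
  by rewrite ltr_pwDl// sumr_ge0// => i _; rewrite sumr_ge0.
apply: norm_le_entries => [|i].
  by rewrite mulr_ge0// addr_ge0// sumr_ge0// => i _; rewrite sumr_ge0.
rewrite mxE (le_trans (ler_norm_sum _ _ _))//.
apply: (@le_trans _ _ (\sum_j `|P i j| * `|x|)).
  by apply: ler_sum => j _; rewrite normrM ler_wpM2l// ler_entry_norm.
rewrite -mulr_suml ler_wpM2r// ler_wpDl//.
by rewrite [leRHS](bigD1 i)//= lerDl sumr_ge0// => k _; rewrite sumr_ge0.
Qed.

Lemma closure_normP (G : set 'cV[R]_d) x :
  closure G x <-> forall e, 0 < e -> exists2 g, G g & `|x - g| < e.
Proof.
split=> [Gx e e0|Gx B /nbhs_ballP[e/= e0 eB]].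
  have [g [Gg]] := Gx _ (nbhsx_ballx x e e0).
  by rewrite mx_norm_ball => xg; exists g.
by have [g Gg xg] := Gx _ e0; exists g; split=> //; apply: eB; rewrite mx_norm_ball.
Qed.

(** Compactness of the closed unit ball, applied to transposes because [bounded_closed_compact] is
    about row vectors. *)
Lemma unit_sequence_cluster (u : nat -> 'cV[R]_d) : (forall n, `|u n| = 1) ->
  exists2 v, v != 0 &
    forall e, 0 < e -> forall N, exists2 n, (N <= n)%N & `|u n - v| < e.
Proof.
move=> u1; pose A := [set x : 'rV[R]_d | `|x| <= 1].
have cA : compact A.
  apply: bounded_closed_compact.
    by exists 1; split => // y y1 x /=; move=> /le_trans; apply; exact: ltW.
  rewrite (_ : A = closed_ball (0 : 'rV[R]_d) 1); first exact: closed_ball_closed.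
  rewrite closed_ballE//; apply/seteqP; split => x /=; rewrite /A /closed_ball_ /=;
    by rewrite sub0r normrN.
have [|v [Av cv]] := cA ((fun n => (u n)^T) @ \oo) _.
  by exists 0%N => // n _ /=; rewrite /A /= norm_trmx u1.
have key e : 0 < e -> forall N, exists2 n, (N <= n)%N & `|u n - v^T| < e.
  move=> e0 N.
  have h : ((fun n => (u n)^T) @ \oo) ((fun n => (u n)^T) @` [set n | (N <= n)%N]).
    by exists N => // n /= Nn; exists n.
  have [_ [[n /= Nn <-]]] := cv _ _ h (nbhsx_ballx v e e0).
  rewrite mx_norm_ball /ball_/= => vn; exists n => //.
  by rewrite -norm_trmx linearB/= trmxK distrC.
exists v^T => //; apply/negP => /eqP v0.
have [n _] := key _ ltr01 0%N.
by rewrite v0 subr0 u1 ltxx.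
Qed.

End matrix_norm.

Section replace_column.
Variables (R : comRingType) (d : nat).
Implicit Types (x : 'cV[R]_d) (P : 'M[R]_d) (j : 'I_d).

(** Multiplication by this matrix on the right exchanges one column, so the effect of an exchange on
    a determinant is read off from [det_replace_col]. *)
Definition replace_col j x : 'M[R]_d :=
  \matrix_(i, k) if k == j then x i 0 else (i == k)%:R.

(** The cofactors along column [j] do not see that column, so they are those of the identity, whose
    adjugate is the identity. *)
Lemma det_replace_col j x : \det (replace_col j x) = x j 0.
Proof.
have cofE i : cofactor (replace_col j x) i j = cofactor 1%:M i j.
  rewrite /cofactor; congr (_ * \det _); apply/matrixP => a b.
  by rewrite !mxE eq_sym (negbTE (neq_lift _ _)).
have adj1 : \adj (1%:M : 'M[R]_d) = 1%:M.
  by have := mul_mx_adj (1%:M : 'M[R]_d); rewrite mul1mx det1.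
rewrite (expand_det_col _ j) (bigD1 j)//= big1 ?addr0 => [|i ij].
  have /matrixP/(_ j j) := adj1; rewrite !mxE eqxx cofE => ->.
  by rewrite mulr1.
have /matrixP/(_ j i) := adj1; rewrite !mxE cofE eq_sym (negbTE ij) => ->.
by rewrite mulr0.
Qed.

Lemma col_mul_replace_col P j x k :
  col k (P *m replace_col j x) = if k == j then P *m x else col k P.
Proof.
apply/matrixP => a b; rewrite !mxE; case: ifPn => [/eqP ->|kj].
  by rewrite mxE (ord1 b); apply: eq_bigr => c _; rewrite mxE eqxx.
rewrite mxE (bigD1 k)//= big1 ?addr0 => [|c ck].
  by rewrite mxE (negbTE kj) eqxx mulr1.
by rewrite mxE (negbTE kj) (negbTE ck) mulr0.
Qed.

End replace_column.

(** * Closed subgroups of R^d *)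

Section subgroups.
Variables (R : realType) (d : nat).
Implicit Types (K G : set 'cV[R]_d) (x y u : 'cV[R]_d) (P C : 'M[R]_d).
Implicit Types (J : {set 'I_d}).

Definition subgroup K := K 0 /\ forall x y, K x -> K y -> K (x - y).

Definition integral_on J x := forall j, j \in J -> x j 0 \is a Num.int.

Lemma subgroupN K x : subgroup K -> K x -> K (- x).
Proof. by move=> [K0 KB] Kx; rewrite -sub0r; exact: KB. Qed.

Lemma subgroupD K x y : subgroup K -> K x -> K y -> K (x + y).
Proof. by move=> sK Kx Ky; rewrite -[y]opprK; apply: sK.2 => //; exact: subgroupN. Qed.

Lemma subgroup_mulrz K x (k : int) : subgroup K -> K x -> K (x *~ k).
Proof.
move=> sK Kx.
have nat_case n : K (x *+ n).
  by elim: n => [|n IH]; [exact: sK.1|rewrite mulrS; exact: subgroupD].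
by case: k => n; [exact: nat_case|apply: subgroupN => //; exact: nat_case].
Qed.

Lemma subgroup_scale_int K x (a : R) :
  subgroup K -> a \is a Num.int -> K x -> K (a *: x).
Proof. by move=> sK /intrP[k ->] Kx; rewrite scaler_int; exact: subgroup_mulrz. Qed.

Lemma subgroup_sum K (f : 'I_d -> 'cV[R]_d) :
  subgroup K -> (forall i, K (f i)) -> K (\sum_i f i).
Proof.
move=> sK Kf; elim/big_ind : _ => //; first exact: sK.1.
by move=> x y; exact: subgroupD.
Qed.

Lemma subgroup_closure K : subgroup K -> subgroup (closure K).
Proof.
move=> sK; split; first by apply: subset_closure; exact: sK.1.
move=> x y /closure_normP Kx /closure_normP Ky; apply/closure_normP => e e0.
have [g Kg xg] := Kx _ (divr_gt0 e0 (@ltr0n R 2)).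
have [h Kh yh] := Ky _ (divr_gt0 e0 (@ltr0n R 2)).
exists (g - h); first exact: sK.2.
rewrite (_ : _ - _ = (x - g) - (y - h)); last by rewrite !opprD !opprK addrACA.
by rewrite (le_lt_trans (ler_normB _ _))// (splitr e) ltrD.
Qed.

Lemma mulmx_col_sum P x : P *m x = \sum_j x j 0 *: col j P.
Proof.
apply/matrixP => a b; rewrite (ord1 b) mxE summxE.
by apply: eq_bigr => j _; rewrite !mxE mulrC.
Qed.

(* The multiples of ever shorter vectors of [K] approximate all multiples of
   a limit of their directions. *)
Lemma closed_subgroup_line K : subgroup K -> closed K ->
  (forall e, 0 < e -> exists x, [/\ K x, x != 0 & `|x| < e]) ->
  exists2 u, u != 0 & forall t, K (t *: u).
Proof.
move=> sK cK Ksmall.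
have /choice[x xP] n : exists x, [/\ K x, x != 0 & `|x| < n.+1%:R^-1].
  by apply: Ksmall; rewrite invr_gt0.
have [|u u0 ucl] := @unit_sequence_cluster R d (fun n => `|x n|^-1 *: x n).
  move=> n; have [_ xn0 _] := xP n.
  by rewrite normrZ ger0_norm ?invr_ge0// mulVf// normr_eq0.
exists u => // t; apply: cK; apply/closure_normP => e e0.
have t1 : 0 < 2 * (`|t| + 1) by rewrite mulr_gt0// ltr_wpDl.
(* Two errors of at most [e / 2] arise: replacing [u] by the direction of [x n], multiplied by [t],
   and taking the integer part of t / |x n|, which costs at most |x n|. *)
have [n /= nN un] := ucl _ (divr_gt0 e0 t1) (Num.truncn (2 / e)).
have [Kxn xn0 xne] := xP n.
have xn_gt0 : 0 < `|x n| by rewrite normr_gt0.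
exists (x n *~ Num.floor (t / `|x n|)); first exact: subgroup_mulrz.
set k := Num.floor _.
have -> : t *: u - x n *~ k =
    t *: (u - `|x n|^-1 *: x n) + (t / `|x n| - k%:~R) *: x n.
  by rewrite -scaler_int scalerBr scalerBl scalerA subrKA.
rewrite (le_lt_trans (ler_normD _ _))// (splitr e) ler_ltD//.
  rewrite normrZ distrC (le_trans (ler_wpM2l (normr_ge0 t) (ltW un)))//.
  rewrite mulrA ler_pdivrMr// mulrC [leRHS](_ : _ = e * (`|t| + 1)); last by field.
  by rewrite ler_pM2l// lerDl.
rewrite normrZ (@le_lt_trans _ _ `|x n|)//.
  rewrite -[leRHS]mul1r ler_wpM2r// ger0_norm ?subr_ge0 ?floor_le//.
  by rewrite lerBlDr addrC -[1](mulr1z 1) -intrD ltW// floorD1_gt.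
rewrite (lt_trans xne)// -[ltRHS]invrK ltf_pV2 ?posrE ?invr_gt0 ?divr_gt0//.
rewrite invf_div (lt_le_trans (truncnS_gt _))//.
by rewrite ler_nat ltnS.
Qed.

End subgroups.

(** Dirichlet's pigeonhole argument: the unit cube is cut into q^d boxes of side 1/q < e, and among
    q^d + 1 consecutive multiples, from 0 on, two have fractional parts in the same box. Their
    difference is the required multiple. *)
Lemma simultaneous_approximation (R : realType) (d : nat) (e : R) : 0 < e ->
  exists N, forall x : 'cV[R]_d, exists k, exists2 z : 'cV[int]_d,
    (0 < k <= N)%N & `|k%:R *: x - map_mx intr z| < e.
Proof.
move=> e0; pose q := (Num.truncn e^-1).+1.
have qe : q%:R^-1 < e.
  by rewrite -[ltRHS]invrK ltf_pV2 ?posrE ?invr_gt0// truncnS_gt.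
exists #|{ffun 'I_d -> 'I_q}| => x.
pose r k i : R := k%:R * x i 0 - (Num.floor (k%:R * x i 0))%:~R.
have r01 k i : 0 <= r k i < 1.
  by have := floor_itv (k%:R * x i 0); rewrite /r intrD; lra.
pose f (k : 'I_#|{ffun 'I_d -> 'I_q}|.+1) : {ffun 'I_d -> 'I_q} :=
  [ffun i => inord (Num.truncn (q%:R * r k i))].
have /injectivePn[k1 [k2 k12 fk]] : ~~ injectiveb f.
  by apply/negP => /injectiveP/leq_card; rewrite card_ord ltnn.
wlog lt12 : k1 k2 k12 fk / (k1 < k2)%N => [hwlog|].
  have := k12; rewrite -val_eqE neq_ltn => /orP[|] lt12; first exact: (hwlog k1 k2).
  by apply: (hwlog k2 k1) => //; rewrite eq_sym.
exists (k2 - k1)%N.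
exists (\col_i (Num.floor (k2%:R * x i 0) - Num.floor (k1%:R * x i 0))).
  by rewrite subn_gt0 lt12/= (leq_trans (leq_subr _ _))// -ltnS.
apply: norm_lt_entries => // i; apply: lt_trans qe.
have -> : (((k2 - k1)%:R *: x - map_mx intr (\col_i
    (Num.floor (k2%:R * x i 0) - Num.floor (k1%:R * x i 0)))) i 0) = r k2 i - r k1 i.
  by rewrite !mxE natrB 1?ltnW// intrB /r; ring.
have q0 : 0 < q%:R :> R by rewrite ltr0n.
rewrite -(ltr_pM2l q0) divff ?gt_eqF// -[X in X * _]ger0_norm ?ltW// -normrM.
have : Num.truncn (q%:R * r k1 i) = Num.truncn (q%:R * r k2 i).
  have lt_q k : (Num.truncn (q%:R * r k i) < q)%N.
    have /andP[r0 r1] := r01 k i.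
    by rewrite truncn_lt_nat ?mulr_ge0// gtr_pMr.
  by move/ffunP : fk => /(_ i); rewrite !ffunE => /(congr1 val)/=; rewrite !inordK.
have /andP[/(mulr_ge0 (ltW q0))/truncn_itv + _] := r01 k1 i.
have /andP[/(mulr_ge0 (ltW q0))/truncn_itv + _] := r01 k2 i.
move=> + + eq_t; rewrite eq_t; move: q%:R (r k2 i) (r k1 i) => c a b.
by rewrite -!natr1 ltr_norml mulrBr; lra.
Qed.

Section closed_subgroups.
Variables (R : realType) (d : nat) (K : set 'cV[R]_d).
Hypotheses (sK : subgroup K) (cK : closed K).
Implicit Types (x y u : 'cV[R]_d) (P C : 'M[R]_d) (J : {set 'I_d}).

(** In the coordinates given by [P], these conditions put every vector that is integral on [J] into
    [K]; but [K] may contain more. *)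
Definition adapted P J := [/\ P \in unitmx, forall i, K (col i P) &
  forall i t, i \notin J -> K (t *: col i P)].

(** For adapted [P], what is left of [K] after splitting off the lines spanned by the columns
    outside [J]. *)
Definition lattice_part P J x := (forall i, i \notin J -> x i 0 = 0) /\ K (P *m x).

Lemma adapted_mulmx P J x : adapted P J -> integral_on J x -> K (P *m x).
Proof.
move=> [_ KP KPJ] xJ; rewrite mulmx_col_sum; apply: subgroup_sum => // j.
by have [/xJ jx|/KPJ//] := boolP (j \in J); exact: subgroup_scale_int.
Qed.

Lemma subgroup_lattice_part P J : subgroup (lattice_part P J).
Proof.
split; first by split=> [i _|]; rewrite ?mxE ?mulmx0//; exact: sK.1.
move=> x y [xJ Kx] [yJ Ky]; split=> [i iJ|]; first by rewrite !mxE xJ// yJ// subr0.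
by rewrite mulmxBr; exact: sK.2.
Qed.

Lemma closed_lattice_part P J : closed (lattice_part P J).
Proof.
move=> x /closure_normP xcl; split=> [i iJ|].
  apply/eqP; rewrite -normr_le0; apply/ler_addgt0Pr => e e0; rewrite add0r.
  have [y [yJ _] xy] := xcl _ e0; apply: ltW; apply: le_lt_trans xy.
  by have := ler_entry_norm (x - y) i; rewrite !mxE yJ// subr0.
apply: cK; apply/closure_normP => e e0; have [c c0 Pc] := mulmx_norm_bound P.
have [y [_ Ky] xy] := xcl _ (divr_gt0 e0 c0); exists (P *m y) => //.
by rewrite -mulmxBr (le_lt_trans (Pc _))// mulrC -ltr_pdivlMr.
Qed.

(* Take [J] of minimal cardinality: a line in [lattice_part P J] could replace a
   column of [P] and allow to remove its index from [J]. *)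
Lemma adapted_discrete P0 : P0 \in unitmx -> (forall i, K (col i P0)) ->
  exists P J, adapted P J /\
  exists2 e, 0 < e & forall x, lattice_part P J x -> `|x| < e -> x = 0.
Proof.
move=> P0u KP0; pose Q n := `[< exists P J, adapted P J /\ #|J| = n >].
have /ex_minnP[n /asboolP[P [J [PJ Jn]]] nmin] : exists n, Q n.
  exists #|[set: 'I_d]%SET|; apply/asboolP; exists P0, [set: 'I_d]%SET; split => //.
  by split=> // i t; rewrite inE.
exists P, J; split => //; apply: contrapT => ndisc.
have [e e0|u u0 uline] := closed_subgroup_line
    (subgroup_lattice_part P J) (@closed_lattice_part P J).
  apply: contrapT => nx; apply: ndisc; exists e => // x xL xe.
  by apply/eqP/negP => /negP x0; apply: nx; exists x.
have [j uj0] : exists j, u j 0 != 0.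
  apply: contrapT => nu; case/eqP: u0; apply/matrixP => j b; rewrite (ord1 b) mxE.
  by apply/eqP/negP => /negP uj; apply: nu; exists j.
have jJ : j \in J.
  apply: contraNT uj0 => jJ; have [/(_ j jJ)] := uline 1.
  by rewrite scale1r => ->.
have KPu t : K (t *: (P *m u)) by have [_] := uline t; rewrite -scalemxAr.
have [Pu KP KPJ] := PJ.
suff : Q #|J :\ j|.
  by move=> /nmin; rewrite -Jn (cardsD1 j J) jJ add1n ltnn.
apply/asboolP; exists (P *m replace_col j u), (J :\ j); split => //; split.
- by rewrite unitmx_mul Pu unitmxE det_replace_col unitfE.
- move=> i; rewrite col_mul_replace_col; case: ifPn => // _.
  by rewrite -[_ *m _]scale1r.
- move=> i t; rewrite col_mul_replace_col !inE negb_and negbK.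
  by case: ifPn => //= _; exact: KPJ.
Qed.

End closed_subgroups.

Lemma col_mulmx (R : pzRingType) m n p (A : 'M[R]_(m, n)) (B : 'M[R]_(n, p)) j :
  col j (A *m B) = A *m col j B.
Proof. by rewrite !colE mulmxA. Qed.

Section closed_subgroup_structure.
Variables (R : realType) (d : nat) (K : set 'cV[R]_d).
Hypotheses (sK : subgroup K) (cK : closed K).
Implicit Types (x y u : 'cV[R]_d) (P C : 'M[R]_d) (J : {set 'I_d}).

(* A multiple [k x] that is close to an integer vector equals it, because their
   difference lies in the discrete group [lattice_part]. *)
Lemma lattice_part_denominator P J : adapted K P J ->
  (exists2 e, 0 < e & forall x, lattice_part K P J x -> `|x| < e -> x = 0) ->
  exists2 m, (0 < m)%N &
    forall x, lattice_part K P J x -> forall i, m%:R * x i 0 \is a Num.int.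
Proof.
move=> PJ [e e0 eL]; have sL := subgroup_lattice_part sK P J.
(* The bound 1 makes the integer vector [z] vanish off [J], which puts it in [lattice_part]; the
   bound [e] then makes [k%:R *: x] equal to it. *)
have e'0 : 0 < Num.min e 1 by rewrite lt_min e0 ltr01.
have [N HN] := simultaneous_approximation d e'0.
(* The factorial is a multiple of every admissible [k], hence a denominator common to all [x]. *)
exists N`! => [|x xL i]; first exact: fact_gt0.
have [k [z /andP[k0 kN]]] := HN x; rewrite lt_min => /andP[ze z1].
have zJ j : j \notin J -> z j 0 = 0.
  move=> jJ; have := le_lt_trans (ler_entry_norm _ j) z1.
  by rewrite !mxE xL.1// mulr0 sub0r normrN -intr_norm ltrz1 => ?; lia.
have zL : lattice_part K P J (map_mx intr z).
  split=> [j jJ|]; first by rewrite mxE zJ.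
  by apply: adapted_mulmx PJ _ => // j _; rewrite mxE.
have /eqP : k%:R *: x - map_mx intr z = 0.
  by apply: eL => //; apply: sL.2 => //; exact: subgroup_scale_int.
rewrite subr_eq0 => /eqP/matrixP/(_ i 0); rewrite !mxE => kz.
have /dvdnP[c ->] : (k %| N`!)%N by rewrite dvdn_fact// k0.
by rewrite natrM -mulrA kz rpredM ?natr_int ?intr_int.
Qed.

(* Once the columns of [C] lie in [K], changing one of them by reducing a vector
   of [K] modulo the others multiplies [\det C] by a factor in [0, 1[; the
   denominator bound makes a smallest positive determinant exist. *)
Theorem closed_subgroup_structure P0 : P0 \in unitmx -> (forall i, K (col i P0)) ->
  exists P J, P \in unitmx /\ forall x, K (P *m x) <-> integral_on J x.
Proof.
move=> P0u KP0; have [P [J [PJ disc]]] := adapted_discrete sK cK P0u KP0.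
have [m m0 mint] := lattice_part_denominator PJ disc.
have [Pu KP KPJ] := PJ.
(* Only the [J] by [J] block of [C] is free. The columns with index in [J] lie in [lattice_part], so
   [m%:R *: C] has integral entries. *)
pose S C := (forall i j, (i \notin J) || (j \notin J) -> C i j = (i == j)%:R) /\
  forall j, K (P *m col j C).
have S_int C : S C -> \det (m%:R *: C) \is a Num.int.
  move=> [Ceq KC]; rewrite /determinant; apply: rpred_sum => s _; rewrite rpredM//.
    by rewrite rpredX ?rpredN ?rpred1.
  apply: rpred_prod => i _; rewrite mxE; have [sJ|sJ] := boolP (s i \in J); last first.
    by rewrite Ceq ?sJ ?orbT// -natrM natr_int.
  have := mint (col (s i) C) _ i; rewrite mxE; apply; split => // k kJ.
  rewrite mxE Ceq ?kJ//; apply/eqP; rewrite pnatr_eq0 eqb0.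
  by apply: contraNneq kJ => ->.
(* The shift by one restricts the minimum to nonzero determinants. *)
pose Q n := `[< exists2 C, S C & `|\det (m%:R *: C)| = n.+1%:R >].
have Q_ex C : S C -> \det C != 0 -> exists2 n, Q n & `|\det (m%:R *: C)| = n.+1%:R.
  move=> SC C0; have : \det (m%:R *: C) != 0.
    by rewrite detZ mulf_neq0// expf_neq0// pnatr_eq0 -lt0n.
  have /intrP[a Ea] := S_int _ SC.
  rewrite Ea intr_eq0 => a0; exists `|a|%N.-1.
    by apply/asboolP; exists C => //; rewrite Ea prednK ?absz_gt0// natr_absz intr_norm.
  by rewrite prednK ?absz_gt0// natr_absz intr_norm.
have /ex_minnP[n /asboolP[C SC Cn] nmin] : exists n, Q n.
  have [||n Qn _] := Q_ex 1%:M; [|by rewrite det1 oner_eq0|by exists n].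
  split=> [i j _|j]; rewrite ?mxE//.
  by rewrite -col_mulmx mulmx1.
have C0 : \det C != 0.
  apply/negP => /eqP C0; move: Cn; rewrite detZ C0 mulr0 normr0 => /eqP.
  by rewrite eq_sym pnatr_eq0.
have [Ceq KC] := SC.
have KJ x : integral_on J x -> K (P *m C *m x).
  apply: adapted_mulmx => //; split => [|i|i t iJ].
  - by rewrite unitmx_mul Pu unitmxE unitfE.
  - by rewrite col_mulmx.
  rewrite col_mulmx (_ : col i C = col i 1%:M).
    by rewrite -col_mulmx mulmx1; exact: KPJ.
  by apply/matrixP => a b; rewrite !mxE Ceq// iJ orbT.
exists (P *m C), J; split; first by rewrite unitmx_mul Pu unitmxE unitfE.
move=> x; split=> [Kx j jJ|]; last exact: KJ.
(* Off [J] the entries are set to 0 instead of reduced, so that [C *m y] is an admissible column for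
   [S]. *)
pose y : 'cV[R]_d := \col_i if i \in J then x i 0 - (Num.floor (x i 0))%:~R else 0.
have Ky : K (P *m C *m y).
  have -> : y = x - (x - y) by rewrite opprB addrC subrK.
  rewrite mulmxBr; apply: sK.2 => //; apply: KJ => i iJ.
  by rewrite !mxE iJ opprB addrC subrK.
have [yj0|yj0] := eqVneq (y j 0) 0.
  by move: yj0; rewrite mxE jJ => /eqP; rewrite subr_eq0 => /eqP ->.
have SC' : S (C *m replace_col j y).
  split=> [a b ab|b].
    have /matrixP/(_ a 0) := col_mul_replace_col C j y b.
    rewrite mxE => ->; case: ifPn ab => [/eqP ->|bj ab]; last by rewrite mxE Ceq.
    rewrite jJ orbF => aJ; rewrite mxE (bigD1 a)//= mxE (negbTE aJ) mulr0 add0r.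
    rewrite big1 => [|i ia]; last by rewrite Ceq ?aJ// eq_sym (negbTE ia) mul0r.
    by case: eqP => // aj; move: aJ; rewrite aj jJ.
  by rewrite col_mul_replace_col; case: ifPn => // _; rewrite mulmxA.
have [|n' Qn' En'] := Q_ex _ SC'; first by rewrite det_mulmx det_replace_col mulf_neq0.
have := nmin _ Qn'; rewrite -ltnS -(ler_nat R) -En' -Cn.
rewrite scalemxAl det_mulmx normrM det_replace_col.
have : 0 < `|\det (m%:R *: C)| by rewrite Cn.
have /andP[y0 y1] : 0 <= y j 0 < 1.
  by rewrite mxE jJ; have := floor_itv (x j 0); rewrite intrD; lra.
by rewrite (ger0_norm y0) => c0; rewrite ler_pMr// leNgt y1.
Qed.

End closed_subgroup_structure.

(** * Lattice bases and the closure of L + M *)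

Section lattice_bases.
Variables (R : realType) (d : nat).
Implicit Types (L G : set 'cV[R]_d) (x : 'cV[R]_d) (P A : 'M[R]_d).

(** Finite families in [L] that span the standard basis vectors are joined; the matrix with these
    rows has rank [d], and [d] independent rows are selected. *)
Lemma full_rank_basis L : full_rank L ->
  exists2 P, P \in unitmx & forall i, L (col i P).
Proof.
move=> rankL; pose e i : 'cV[R]_d := delta_mx i 0.
have /choice[X XP] i : exists X : seq 'cV[R]_d, [set` X] `<=` L /\ e i \in <<X>>%VS.
  by have [X XL eX] := rankL (e i); exists X.
pose Y := [seq v | i <- enum 'I_d, v <- X i].
have YL v : v \in Y -> L v.
  by move=> /allpairsPdep[i [w [_ wX ->]]]; exact: (XP i).1.
have eY i : e i \in <<Y>>%VS.
  apply: subvP (XP i).2; apply: sub_span => v vX.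
  by apply/allpairsPdep; exists i, v; rewrite mem_enum.
pose M : 'M[R]_(size Y, d) := \matrix_(k, i) Y`_k i 0.
have fullM : row_full M.
  rewrite -sub1mx; apply/row_subP => i; apply/submxP.
  exists (\row_k coord (in_tuple Y) k (e i)).
  have -> : row i 1%:M = (e i)^T.
    by apply/matrixP => a b; rewrite !mxE (ord1 a) eqxx andbT eq_sym.
  rewrite [in LHS](@coord_span _ _ _ (in_tuple Y) _ (eY i)); apply/matrixP => a b.
  rewrite mxE summxE [RHS]mxE; apply: eq_bigr => k _; rewrite !mxE.
  by rewrite (ord1 a).
exists (rowsub (fullrankfun fullM) M)^T => [|i].
  by rewrite unitmx_tr -row_full_unit; exact: fullrowsub_full.
rewrite (_ : col i _ = Y`_(fullrankfun fullM i)); first by apply: YL; exact: mem_nth.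
by apply/matrixP => a b; rewrite !mxE (ord1 b).
Qed.

Lemma lattice_separated L : lattice L ->
  exists2 e, 0 < e & forall x, L x -> `|x| < e -> x = 0.
Proof.
move=> [L0 _ iL]; have [_ [V /nbhs_ballP[e/= e0 eV] VL]] := iL _ L0.
exists e => // x Lx xe; have : (V `&` L) x.
  by split => //; apply: eV; rewrite mx_norm_ball /ball_/= sub0r normrN.
by rewrite VL.
Qed.

(** Points of [L] within half the separation of [x] coincide, so all close approximations of [x] are
    the same [g]. *)
Lemma lattice_closed L : lattice L -> closed L.
Proof.
move=> latL; have [e e0 eL] := lattice_separated latL; have [_ LB _] := latL.
move=> x /closure_normP xL.
have e2 : 0 < e / 2 by rewrite divr_gt0.
have [g Lg xg] := xL _ e2; suff -> : x = g by [].
apply/eqP; rewrite -subr_eq0 -normr_le0; apply/ler_addgt0Pr => r r0; rewrite add0r.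
have [h Lh] : exists2 h, L h & `|x - h| < Num.min r (e / 2).
  by apply: xL; rewrite lt_min r0.
rewrite lt_min => /andP[xhr xh].
suff /subr0_eq <- : h - g = 0 by exact: ltW.
apply: eL; first exact: LB.
have -> : h - g = (x - g) - (x - h) by rewrite opprB [RHS]addrC subrKA.
by rewrite (le_lt_trans (ler_normB _ _))// (splitr e) ltrD.
Qed.

(** In [closed_subgroup_structure] the set [J] must contain every index: one outside [J] would give
    a line in [L], hence nonzero vectors shorter than the separation. *)
Lemma lattice_basis L : lattice L -> full_rank L ->
  exists2 A, A \in unitmx & L = lattice_of A.
Proof.
move=> latL /full_rank_basis[P0 P0u LP0]; have [L0 LB _] := latL.
have [P [J [Pu PJ]]] :=
  closed_subgroup_structure (conj L0 LB) (lattice_closed latL) P0u LP0.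
have [e e0 eL] := lattice_separated latL.
have [c c0 Pc] := mulmx_norm_bound P.
have JT i : i \in J.
  apply/negPn/negP => iJ; pose t := e / (2 * c).
  have t0 : 0 < t by rewrite divr_gt0// mulr_gt0.
  have : P *m (t *: delta_mx i 0) = 0 :> 'cV[R]_d.
    apply: eL.
      apply/PJ => j jJ; rewrite !mxE; case: eqP => [ji|]; last by rewrite mulr0.
      by move: iJ; rewrite -ji jJ.
    rewrite (le_lt_trans (Pc _))// normrZ (ger0_norm (ltW t0)).
    have : `|delta_mx i 0 : 'cV[R]_d| <= 1.
      apply: norm_le_entries => // k; rewrite mxE eqxx andbT.
      by rewrite ger0_norm ?ler0n// lern1 leq_b1.
    move=> /(ler_wpM2l (ltW t0))/(ler_wpM2l (ltW c0))/le_lt_trans; apply.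
    by rewrite mulr1 /t (_ : c * _ = e / 2); [lra|field; rewrite gt_eqF].
  move=> /(congr1 (mulmx (invmx P))); rewrite mulKmx// mulmx0.
  move=> /matrixP/(_ i 0); rewrite !mxE !eqxx mulr1 => t_eq0.
  by move: t0; rewrite t_eq0 ltxx.
exists P => //; apply/seteqP; split => [x|_ [z _ <-]]; last first.
  by apply/PJ => j _; rewrite mxE.
rewrite -[x in L x](mulKVmx Pu) => /PJ xint.
exists (\col_j Num.floor ((invmx P *m x) j 0)) => //.
rewrite -[RHS](mulKVmx Pu); congr (_ *m _); apply/matrixP => j b.
by rewrite [LHS]mxE mxE (ord1 b) floorK//; exact: xint.
Qed.

(** The matrix is one that produced the value taken by [xget]; by [lattice_basis] that value is not
    the default. *)
Lemma vol_basis L : lattice L -> full_rank L ->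
  exists A, [/\ A \in unitmx, L = lattice_of A & vol L = `|\det A|].
Proof.
move=> latL rankL; have [A Au LA] := lattice_basis latL rankL.
pose S := [set v | exists A, [/\ A \in unitmx, L = lattice_of A & v = `|\det A|]].
by have : S (vol L) by apply: (@xgetPex _ _ S); exists `|\det A|, A.
Qed.

(** This is [closed_subgroup_structure] for the closure of [G]; it serves for the sum of the two
    lattices. *)
Lemma subgroup_density G P0 : subgroup G -> P0 \in unitmx -> (forall i, G (col i P0)) ->
  exists P (J : {set 'I_d}), [/\ P \in unitmx,
    forall g, G g -> integral_on J (invmx P *m g) &
    forall x, integral_on J x -> forall e, 0 < e ->
      exists2 g, G g & `|invmx P *m g - x| < e].
Proof.
move=> sG P0u GP0.
have [P [J [Pu PJ]]] := closed_subgroup_structure (subgroup_closure sG)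
  (@closed_closure _ _) P0u (fun i => subset_closure (GP0 i)).
exists P, J; split => // [g Gg|x /PJ/closure_normP xG e e0].
  by apply/PJ; rewrite mulKVmx//; exact: subset_closure.
have [c c0 Pc] := mulmx_norm_bound (invmx P).
have [g Gg xg] := xG _ (divr_gt0 e0 c0); exists g => //.
rewrite distrC -[x](mulKmx Pu) -mulmxBr (le_lt_trans (Pc _))//.
by rewrite mulrC -ltr_pdivlMr.
Qed.

End lattice_bases.

(** * Cosets of an integer matrix *)

(** By the Smith normal form A = U D V, the quotient by the image of [A] is a product of cyclic
    groups of orders |m i|; the representatives are the images under [U] of vectors of residues. *)
Lemma int_matrix_transversal d (A : 'M[int]_d) : \det A != 0 ->
  exists (T : finType) (rep : T -> 'cV[int]_d), [/\ #|T| = `|\det A|%N,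
    forall z, exists c w, z = rep c + A *m w &
    forall c c' w, rep c - rep c' = A *m w -> c = c'].
Proof.
move=> A0; have [U Uu [V Vu [s _ AE]]] := int_Smith_normal_form A.
pose m (i : 'I_d) : int := s`_i.
pose D : 'M[int]_d := diag_mx (\row_i m i).
have {}AE : A = U *m D *m V.
  by rewrite AE; congr (_ *m _ *m _); apply/matrixP => i j; rewrite !mxE.
have abs_unit (W : 'M[int]_d) : W \in unitmx -> `|\det W|%N = 1%N.
  by rewrite unitmxE => /orP[]/eqP ->.
have detE : `|\det A|%N = (\prod_(i < d) `|m i|)%N.
  rewrite AE !det_mulmx !abszM (abs_unit U)// (abs_unit V)// mul1n muln1 det_diag.
  rewrite (big_morph absz abszM (erefl _)).
  by apply: eq_bigr => i _; rewrite mxE.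
have s0 (i : 'I_d) : m i != 0.
  rewrite -absz_eq0; apply: contra_neq A0 => si0; apply/eqP.
  by rewrite -absz_eq0 detE (bigD1 i)//= si0 mul0n.
have mod_lt (i : 'I_d) (a : int) : (`|(a %% m i)%Z| < `|m i|)%N.
  by have := ltz_mod a (s0 i); have := modz_ge0 a (s0 i); lia.
exists {dffun forall i : 'I_d, 'I_(`|m i|)}.
exists (fun c : {dffun forall i : 'I_d, 'I_(`|m i|)} => U *m \col_i (c i : nat)%:Z).
split => [|z|c c' w].
- rewrite card_dep_ffun detE foldrE big_image/=.
  by apply: eq_bigr => i _; rewrite card_ord.
- pose y i := (invmx U *m z) i 0.
  exists [ffun i => Ordinal (mod_lt i (y i))].
  exists (invmx V *m \col_i (y i %/ m i)%Z).
  rewrite AE !mulmxA mulmxK// -mulmxA -mulmxDr -[LHS](mulKVmx Uu).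
  congr (_ *m _); apply/matrixP => i j; rewrite (ord1 j) mul_diag_mx !mxE ffunE /=.
  by rewrite gez0_abs ?modz_ge0// addrC mulrC -divz_eq /y mxE.
rewrite -mulmxBr AE -!mulmxA => /(congr1 (mulmx (invmx U))).
rewrite !mulKmx// => /matrixP cc'; apply/ffunP => i; apply: val_inj.
have := cc' i 0; rewrite mul_diag_mx !mxE => cE.
have := ltn_ord (c i); have := ltn_ord (c' i).
move: cE; set x := \sum_j _ => cE /=.
have [x0|x0] := eqVneq x 0; first by move: cE; rewrite x0 mulr0; lia.
have : (`|m i| <= `|(m i * x)%R|)%N by rewrite abszM leq_pmulr// absz_gt0.
by rewrite -cE; lia.
Qed.

(** * Measurability *)

Section lebesgue_measurability.
Variables (R : realType) (d : nat).
Implicit Types (f : lebesgue_space R d -> 'cV[R]_d) (i : 'I_d).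

(** A section of [e] turns the left sum into a part of the right one. Since covers are sets, boxes
    of a cover that become equal when cut are counted once. *)
Lemma esum_image_le (S T : choiceType) (P : set S) (e : S -> T) (a : T -> \bar R) :
  (forall t, 0 <= a t)%E ->
  (\esum_(t in e @` P) a t <= \esum_(s in P) a (e s))%E.
Proof.
move=> a0; have [->|/set0P[s0 Ps0]] := eqVneq P set0.
  by rewrite image_set0 !esum_set0.
have /choice[g gP] t : exists s, (e @` P) t -> P s /\ e s = t.
  by have [[s Ps <-]|] := pselect ((e @` P) t); [exists s|exists s0].
rewrite (@eq_esum _ _ _ _ (fun t => a (e (g t)))) => [|t /gP[_ ->]//].
rewrite -(@esum_image _ _ _ _ g (fun s => a (e s))); last first.
  by move=> t u /set_mem/gP[_ {2}<-] /set_mem/gP[_ {2}<-] ->.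
rewrite esum_mkcond [leRHS]esum_mkcond; apply: le_esum => s _.
case: ifPn => [/set_mem[t /gP[Pt _] <-]|_]; first by rewrite mem_set.
by case: ifPn.
Qed.

(** The two pieces of a box on either side of the hyperplane x_i = c; a piece without points has
    volume 0, thanks to the [max] in [box_volume]. *)
Let cut_below i (c : R) (ab : 'cV[R]_d * 'cV[R]_d) :=
  (ab.1, \col_k if k == i then Num.min (ab.2 k 0) c else ab.2 k 0).

Let cut_above i (c : R) (ab : 'cV[R]_d * 'cV[R]_d) :=
  (\col_k (if k == i then Num.max (ab.1 k 0) c else ab.1 k 0), ab.2).

Let box_volume_cut i c ab :
  box_volume ab = box_volume (cut_below i c ab) + box_volume (cut_above i c ab).
Proof.
have volE ab' : box_volume ab' = Num.max 0 (ab'.2 i 0 - ab'.1 i 0) *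
    \prod_(k | k != i) Num.max 0 (ab'.2 k 0 - ab'.1 k 0).
  by rewrite /box_volume (bigD1 i).
rewrite !volE /= !mxE eqxx.
rewrite [X in _ = _ * X + _](eq_bigr (fun k => Num.max 0 (ab.2 k 0 - ab.1 k 0))).
  rewrite [X in _ = _ + _ * X](eq_bigr (fun k => Num.max 0 (ab.2 k 0 - ab.1 k 0))).
    rewrite -mulrDl; congr (_ * _).
    move: (ab.1 i 0) (ab.2 i 0) => a b.
    case: (leP b c) => bc; case: (leP a c) => ac;
      case: (leP 0 (b - a)) => ba; try case: (leP 0 (c - a)) => ca;
      try case: (leP 0 (b - c)) => cb; lra.
  by move=> k ki; rewrite !mxE (negbTE ki).
by move=> k ki; rewrite !mxE (negbTE ki).
Qed.

(** Cutting the boxes of a cover of [X] along the hyperplane gives covers of the two parts of [X],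
    without increasing the total volume. *)
Lemma measurable_halfspace i (c : R) :
  measurable ([set x | x i 0 <= c] : set (lebesgue_space R d)).
Proof.
apply: le_caratheodory_measurable => X.
apply: le_ereal_inf_tmp => _ [C [cC XC] <-].
rewrite (eq_esum (fun ab _ => congr1 EFin (box_volume_cut i c ab))).
under eq_esum do rewrite EFinD.
rewrite esumD => [|ab _|ab _]; try exact: box_volume_ge0.
apply: leeD.
  apply: (le_trans _ (@esum_image_le _ _ C (cut_below i c)
      (fun ab => (box_volume ab)%:E) (@box_volume_ge0 _ _))).
  apply: ereal_inf_lbound; exists (cut_below i c @` C) => //; split.
    exact: card_le_trans (card_image_le _ _) cC.
  move=> x [/XC[ab Cab xab] /= xc]; exists (cut_below i c ab); first by exists ab.
  move=> k /=; rewrite mxE; have /andP[-> xk] := xab k.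
  by case: ifPn => // /eqP ki; rewrite le_min xk/= ki.
apply: (le_trans _ (@esum_image_le _ _ C (cut_above i c)
      (fun ab => (box_volume ab)%:E) (@box_volume_ge0 _ _))).
apply: ereal_inf_lbound; exists (cut_above i c @` C) => //; split.
  exact: card_le_trans (card_image_le _ _) cC.
move=> x [/XC[ab Cab xab] /= /negP xc]; exists (cut_above i c ab); first by exists ab.
move=> k /=; rewrite mxE; have /andP[xk ->] := xab k; rewrite andbT.
by case: ifPn => // /eqP ki; rewrite gt_max xk/= ki ltNge.
Qed.

(** Measurability is tested on coordinates, where the results on real functions apply. *)
Definition measurable_map f := forall i, measurable_fun setT (fun x => f x i 0).

Lemma measurable_map_id : measurable_map id.
Proof.
move=> i mT; apply: (measurability _ (RGenOInfty.measurableE R)) => //.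
move=> _ [_ [c ->] <-]; rewrite setTI.
rewrite (_ : _ @^-1` _ = ~` [set x : lebesgue_space R d | x i 0 <= c]).
  by apply: measurableC; exact: measurable_halfspace.
by apply/seteqP; split => x /=; rewrite in_itv/= andbT ltNge => /negP.
Qed.

Lemma measurable_map_mulmx (P : 'M[R]_d) f :
  measurable_map f -> measurable_map (fun x => P *m f x).
Proof.
move=> mf i; under eq_fun do rewrite mxE.
by apply: measurable_sum => k; apply: measurable_funM => //; exact: mf.
Qed.

Lemma measurable_map_subr (v : 'cV[R]_d) f :
  measurable_map f -> measurable_map (fun x => f x - v).
Proof.
move=> mf i; under eq_fun do rewrite !mxE.
by apply: measurable_funB => //; exact: mf.
Qed.

(** A retraction onto the points integral on [J]; its fibres are translates of [0, 1[ in the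
    [J]-coordinates. *)
Definition floor_on (J : {set 'I_d}) (x : 'cV[R]_d) : 'cV[R]_d :=
  \col_i if i \in J then (Num.floor (x i 0))%:~R else x i 0.

Lemma measurable_map_floor_on J f :
  measurable_map f -> measurable_map (fun x => floor_on J (f x)).
Proof.
move=> mf i; under eq_fun do rewrite mxE.
case: (i \in J); last exact: mf.
have mfloor : measurable_fun setT (fun a : R => (Num.floor a)%:~R : R).
  by apply: nondecreasing_measurable => // a b ab; rewrite ler_int le_floor.
exact: (measurableT_comp mfloor (mf i)).
Qed.

Lemma measurable_floor_fiber f (r : 'cV[int]_d) : measurable_map f ->
  measurable ([set x | map_mx Num.floor (f x) = r] : set (lebesgue_space R d)).
Proof.
move=> mf.
rewrite (_ : [set x | _] =
    \bigcap_(i in [set: 'I_d])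
      (fun x => f x i 0) @^-1` `[(r i 0)%:~R, (r i 0 + 1)%:~R[).
  apply: fin_bigcap_measurable => [|i _]; first exact: finite_finset.
  by rewrite -[_ @^-1` _]setTI; apply: mf => //; exact: measurable_itv.
apply/seteqP; split => [x /= <- i _ /=|x /= fx].
  by rewrite in_itv/= mxE; exact: floor_itv.
apply/matrixP => i j; rewrite (ord1 j) mxE; apply/eqP; rewrite floor_eq.
by have := fx i I; rewrite /= in_itv.
Qed.

End lebesgue_measurability.

(** * Rounding a lattice basis *)

Section matrix_limits.
Variable R : realType.

Definition mx_cvg m n (u : nat -> 'M[R]_(m, n)) (A : 'M[R]_(m, n)) :=
  forall i j, u k i j @[k --> \oo] --> A i j.

Lemma mx_cvg_cst m n (A : 'M[R]_(m, n)) : mx_cvg (fun=> A) A.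
Proof. by move=> i j; exact: cvg_cst. Qed.

Lemma mx_cvg_mul m n p u v (A : 'M[R]_(m, n)) (B : 'M[R]_(n, p)) :
  mx_cvg u A -> mx_cvg v B -> mx_cvg (fun k => u k *m v k) (A *m B).
Proof.
move=> uA vB i j; under eq_fun do rewrite mxE.
rewrite mxE; apply: cvg_big => [|k _]; first exact: add_continuous.
by apply: cvgM; [exact: uA|exact: vB].
Qed.

Lemma cvg_det n u (A : 'M[R]_n) : mx_cvg u A -> \det (u k) @[k --> \oo] --> \det A.
Proof.
move=> uA; rewrite /determinant; apply: cvg_big => [|s _]; first exact: add_continuous.
apply: cvgM; first exact: cvg_cst.
by apply: cvg_big => [|i _]; [exact: mul_continuous|exact: uA].
Qed.

Lemma mx_cvg_inv n u (A : 'M[R]_n) : A \in unitmx -> mx_cvg u A ->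
  mx_cvg (fun k => invmx (u k)) (invmx A).
Proof.
move=> Au uA i j.
have detA0 : \det A != 0 by move: Au; rewrite unitmxE unitfE.
have cvg_cof : cofactor (u k) j i @[k --> \oo] --> cofactor A j i.
  apply: cvgM; first exact: cvg_cst.
  apply: cvg_det => a b; rewrite !mxE.
  by under eq_fun do rewrite !mxE; exact: uA.
(* A singular matrix is its own [invmx], so the cofactor formula holds only for large [k]. *)
apply: (@cvg_trans _ ((\det (u k))^-1 * cofactor (u k) j i @[k --> \oo])).
  apply: near_eq_cvg; near=> k.
  have uk : u k \in unitmx.
    by rewrite unitmxE unitfE; near: k; exact: cvgr_neq0 (cvg_det uA) detA0.
  by rewrite /invmx uk !mxE.
rewrite /invmx Au !mxE; apply: cvgM => //.
by apply: cvgV => //; exact: cvg_det.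
Unshelve. all: by end_near. Qed.

End matrix_limits.

Arguments mx_cvg_cst {R m n} A i j : rename.
Arguments mx_cvg_mul {R m n p u v A B} uA vB i j : rename.
Arguments mx_cvg_inv {R n u A} Au uA i j : rename.

Section lattice_approximation.
Variables (R : realType) (d : nat) (J : {set 'I_d}).
Implicit Types (A B : 'M[R]_d) (v : R).

Definition scale v : 'M[R]_d := diag_mx (\row_i if i \in J then 1 else v).

Definition int_approx v A : 'M[int]_d := map_mx Num.floor (scale v *m A).

(** The rounded matrix scaled back to the size of [A]. *)
Definition rat_approx v A : 'M[R]_d := scale v^-1 *m map_mx intr (int_approx v A).

Lemma scale_mul v w : scale v *m scale w = scale (v * w).
Proof.
apply/matrixP => i j; rewrite mul_diag_mx !mxE; case: (i \in J) => //.
  by rewrite mul1r.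
by rewrite mulrnAr.
Qed.

Lemma scale1 : scale 1 = 1%:M.
Proof. by apply/matrixP => i j; rewrite !mxE if_same. Qed.

Lemma det_scale v : \det (scale v) = v ^+ #|~: J|.
Proof.
rewrite det_diag (bigID (mem J))/= big1 ?mul1r => [|i iJ]; last by rewrite mxE iJ.
rewrite (eq_bigr (fun=> v)) => [|i iJ]; last by rewrite mxE (negbTE iJ).
by rewrite prodr_const; congr (_ ^+ _); apply: eq_card => i; rewrite !inE.
Qed.

Lemma rat_approxK v A : v != 0 ->
  map_mx intr (int_approx v A) = scale v *m rat_approx v A.
Proof. by move=> v0; rewrite mulmxA scale_mul divff// scale1 mul1mx. Qed.

Lemma scale_mulE n v (A : 'M[R]_(d, n)) i j :
  (scale v *m A) i j = (if i \in J then 1 else v) * A i j.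
Proof. by rewrite mul_diag_mx !mxE. Qed.

Lemma rat_approxE v A i j : rat_approx v A i j =
  if i \in J then (Num.floor (A i j))%:~R else v^-1 * (Num.floor (v * A i j))%:~R.
Proof.
rewrite /rat_approx scale_mulE mxE mxE scale_mulE.
by case: ifP; rewrite ?mul1r.
Qed.

Lemma rat_approx_int_row v A j k : j \in J -> A j k \is a Num.int ->
  rat_approx v A j k = A j k.
Proof. by move=> jJ Aint; rewrite rat_approxE jJ floorK. Qed.

(** Rows in [J] are kept exactly; elsewhere, rounding at scale [v] costs at most 1/v. *)
Lemma rat_approx_cvg c A : 0 < c ->
  (forall j k, j \in J -> A j k \is a Num.int) ->
  mx_cvg (fun n => rat_approx (c * n.+1%:R) A) A.
Proof.
move=> c0 AJ i j; have [iJ|iJ] := boolP (i \in J).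
  under eq_fun do rewrite rat_approx_int_row ?AJ//.
  exact: cvg_cst.
apply/cvgrPdist_le => e e0; near=> n.
have v0 : 0 < c * n.+1%:R by rewrite mulr_gt0.
have ve : 1 <= e * (c * n.+1%:R).
  rewrite mulrA -ler_pdivrMl ?mulr_gt0// mulr1 (@le_trans _ _ n%:R) ?ler_nat//.
  by near: n; exact: nbhs_infty_ger.
rewrite rat_approxE (negbTE iJ).
move: (c * n.+1%:R) v0 ve => v v0 ve.
have -> : A i j - v^-1 * (Num.floor (v * A i j))%:~R =
    v^-1 * (v * A i j - (Num.floor (v * A i j))%:~R).
  by rewrite mulrBr mulKf ?gt_eqF.
rewrite normrM gtr0_norm ?invr_gt0// mulrC ler_pdivrMr//.
apply: le_trans ve; rewrite ger0_norm ?subr_ge0 ?floor_le// ltW//.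
by have := floor_itv (v * A i j); rewrite intrD; lra.
Unshelve. all: by end_near. Qed.

Lemma bernoulli (t : R) n : 0 <= t <= 1 -> 1 - n%:R * t <= (1 - t) ^+ n.
Proof.
move=> /andP[t0 t1]; elim: n => [|n IH]; first by rewrite mul0r subr0 expr0.
have n0 : 0 <= n%:R :> R by [].
rewrite exprS -natr1; apply: (@le_trans _ _ ((1 - t) * (1 - n%:R * t))).
  by nra.
by rewrite ler_wpM2l// subr_ge0.
Qed.

(** The determinants of the roundings are [v ^+ m] and [(t * v) ^+ m] times those of the
    [rat_approx] matrices. For [t] close to 1 the strict inequality survives the factor [t ^+ m],
    and then passes to the approximations for large [v]. *)
Lemma int_approx_exists A B : A \in unitmx -> B \in unitmx ->
  (forall j k, j \in J -> A j k \is a Num.int) ->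
  (forall j k, j \in J -> B j k \is a Num.int) ->
  `|\det A| < `|\det B| ->
  exists2 t : R, 0 < t < 1 & forall e, 0 < e -> exists v, [/\ 0 < v,
    \det (int_approx v A) != 0,
    (`|\det (int_approx v A)| <= `|\det (int_approx (t * v) B)|)%N &
    forall i k, `|(rat_approx (t * v) B *m invmx B *m A *m invmx (rat_approx v A)) i k
                 - (i == k)%:R| < e].
Proof.
move=> Au Bu AJ BJ AB; pose m := #|~: J|.
have detA0 : 0 < `|\det A| by rewrite normr_gt0 -unitfE -unitmxE.
have [t t01 tAB] : exists2 t : R, 0 < t < 1 & `|\det A| < t ^+ m * `|\det B|.
  pose r := `|\det A| / `|\det B|.
  have r1 : r < 1 by rewrite ltr_pdivrMr ?mul1r// (lt_trans detA0).
  have r0 : 0 < r by rewrite divr_gt0// (lt_trans detA0).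
  (* By Bernoulli (1 - s)^m >= 1 - m s = r + s > r; dividing by [m.+1] instead of [m] keeps this
     strict. *)
  pose s := (1 - r) / (m.+1)%:R.
  have s0 : 0 < s by rewrite divr_gt0 ?subr_gt0.
  have sE : m%:R * s + s = 1 - r.
    by rewrite -{2}(mul1r s) -mulrDl natr1 mulrC divfK.
  have ms0 : 0 <= m%:R * s by rewrite mulr_ge0// ltW.
  exists (1 - s); first by lra.
  rewrite -ltr_pdivrMr ?(lt_trans detA0)// -/r.
  have s01 : 0 <= s <= 1 by lra.
  by apply: lt_le_trans (bernoulli m s01); lra.
have /andP[t0 t1] := t01.
exists t => // e e0.
have cA : mx_cvg (fun n => rat_approx n.+1%:R A) A.
  move=> i j; have := @rat_approx_cvg 1 A ltr01 AJ i j.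
  by under eq_fun do rewrite mul1r.
have cB : mx_cvg (fun n => rat_approx (t * n.+1%:R) B) B by exact: rat_approx_cvg.
(* The limit is B B^-1 A A^-1 = 1. *)
have cS := mx_cvg_mul (mx_cvg_mul (mx_cvg_mul cB (mx_cvg_cst (invmx B)))
  (mx_cvg_cst A)) (mx_cvg_inv Au cA).
rewrite mulmxV// mul1mx mulmxV// in cS.
have detE v (C : 'M[R]_d) : v != 0 ->
    (\det (int_approx v C))%:~R = v ^+ m * \det (rat_approx v C).
  by move=> v0; rewrite -det_map_mx rat_approxK// det_mulmx det_scale.
suff : \forall n \near \oo, [/\ \det (rat_approx n.+1%:R A) != 0,
    `|\det (rat_approx n.+1%:R A)| < t ^+ m * `|\det (rat_approx (t * n.+1%:R) B)| &
    forall ik : 'I_d * 'I_d, `|(rat_approx (t * n.+1%:R) B *m invmx B *m A *m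
      invmx (rat_approx n.+1%:R A)) ik.1 ik.2 - (ik.1 == ik.2)%:R| < e].
  move=> /filter_ex[n [A0 ltAB Se]]; exists n.+1%:R; split => //.
  - by rewrite -(intr_eq0 R) detE// mulf_neq0// expf_neq0.
  - rewrite -(ler_nat R) !natr_absz !intr_norm !detE ?mulf_neq0 ?gt_eqF//.
    rewrite !normrM !(ger0_norm (exprn_ge0 _ _)) ?mulr_ge0 ?ltW// exprMn.
    by rewrite [ltLHS]mulrC [ltRHS]mulrAC ltr_pM2r ?exprn_gt0.
  - by move=> i k; exact: (Se (i, k)).
near=> n; split.
- by near: n; apply: cvgr_neq0 (cvg_det cA) _; rewrite -normr_gt0.
- rewrite -subr_gt0; near: n.
  apply: (@cvgr_gt _ _ _ _ _ (t ^+ m * `|\det B| - `|\det A|)); last by rewrite subr_gt0.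
  apply: cvgB; last by apply: cvg_norm; exact: cvg_det.
  by apply: cvgM; [exact: cvg_cst|apply: cvg_norm; exact: cvg_det].
- near: n; apply: filter_forall => -[i k] /=; near=> n.
  rewrite distrC; near: n; apply: cvgr_dist_lt => //.
  by have := cS i k; rewrite mxE.
Unshelve. all: by end_near. Qed.

End lattice_approximation.

(** * Cells *)

Section cells.
Variables (R : realType) (d : nat) (J : {set 'I_d}).
Implicit Types (X Y P : 'M[R]_d) (x y h q : 'cV[R]_d) (r s : 'cV[int]_d).

Definition fixes_coords Y := forall x j, j \in J -> (Y *m x) j 0 = x j 0.

Lemma fixes_coords_inv Y : Y \in unitmx -> fixes_coords Y -> fixes_coords (invmx Y).
Proof.
by move=> Yu YJ x j jJ; have := YJ (invmx Y *m x) j jJ; rewrite mulKVmx.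
Qed.

Lemma floor_onD x g : integral_on J g -> floor_on J (x + g) = floor_on J x + g.
Proof.
move=> gJ; apply/matrixP => i j; rewrite (ord1 j) !mxE; have [iJ|//] := boolP (i \in J).
by rewrite (floorDrz _ (gJ i iJ)) intrD (floorK (gJ i iJ)).
Qed.

Lemma integral_floor_on x : integral_on J (floor_on J x).
Proof. by move=> j jJ; rewrite mxE jJ. Qed.

Lemma floor_frac x r : map_mx Num.floor x = r ->
  forall i, 0 <= (x - map_mx intr r) i 0 < 1.
Proof.
by move=> <- i; rewrite !mxE; have := floor_itv (x i 0); rewrite intrD; lra.
Qed.

(* [x |-> floor (Y x)] and [x |-> floor (X x)] cut the points that are integral
   on [J] into cells; the last hypothesis says that a cell of the first kind fits,
   with room to spare, into one of the second kind. *)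
Lemma cell_transport X Y (e : R) r s : 0 < e ->
  X \in unitmx -> Y \in unitmx -> fixes_coords X -> fixes_coords Y ->
  (forall q, (forall j, j \in J -> q j 0 = 0) -> (forall i, 0 <= q i 0 < 1) ->
    forall i, i \notin J -> - e < (X *m invmx Y *m q) i 0 < 1 - 3 * e) ->
  exists2 h, integral_on J h & exists2 t, 0 < t & forall g, integral_on J g ->
    `|g - h| < t -> forall y, integral_on J y ->
    map_mx Num.floor (Y *m y) = r -> map_mx Num.floor (X *m (y + g)) = s.
Proof.
move=> e0 Xu Yu XJ YJ XY.
(* The shift by [2 * e] moves the range ]-e, 1 - 3e[ to ]e, 1 - e[, which leaves a margin [e] on
   both sides for the error [g - h]. *)
pose w : 'cV[R]_d := \col_i if i \in J then 0 else 2 * e.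
pose h := invmx X *m (map_mx intr s + w) - invmx Y *m map_mx intr r.
have hJ j : j \in J -> h j 0 = (s j 0)%:~R - (r j 0)%:~R.
  move=> jJ; rewrite mxE fixes_coords_inv// mxE [X in _ + X]mxE fixes_coords_inv//.
  by rewrite !mxE jJ addr0.
exists h; first by move=> j jJ; rewrite hJ// -intrB.
have [c c0 Xc] := mulmx_norm_bound X.
(* Below 1, integrality forces [g] and [h] to agree on [J]; below [e / c], the entries of
   [X *m (g - h)] are less than [e]. *)
exists (Num.min 1 (e / c)); first by rewrite lt_min ltr01 divr_gt0.
move=> g gJ; rewrite lt_min => /andP[gh1 ghe] y yJ Yyr.
have gE j : j \in J -> g j 0 = h j 0.
  move=> jJ; have := le_lt_trans (ler_entry_norm (g - h) j) gh1.
  rewrite mxE [X in _ + X]mxE hJ//; have /intrP[a ->] := gJ j jJ.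
  by rewrite -!intrB -intr_norm ltrz1 => ?; congr (_%:~R); lia.
pose q := Y *m y - map_mx intr r.
have q01 := floor_frac Yyr; rewrite -/q in q01.
have qJ j : j \in J -> q j 0 = 0.
  move=> jJ; have := q01 j; rewrite /q mxE YJ//; have /intrP[a ->] := yJ j jJ.
  rewrite !mxE -intrB ler0z ltrz1 => ?.
  by rewrite (_ : a - r j 0 = 0)//; lia.
have XE : X *m (y + g) = map_mx intr s + w + X *m invmx Y *m q + X *m (g - h).
  rewrite /q mulmxBr -mulmxA mulKmx// /h -!mulmxA !(mulmxBr, mulmxDr) !mulmxA.
  rewrite mulmxV// !mul1mx.
  set a := X *m y; set b := X *m g; set k := X *m _ *m _.
  by apply/matrixP => i j; rewrite !mxE; ring.
have ce i : `|(X *m (g - h)) i 0| < e.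
  rewrite (le_lt_trans (ler_entry_norm _ _))// (le_lt_trans (Xc _))//.
  by rewrite mulrC -ltr_pdivlMr.
apply/matrixP => i j; rewrite (ord1 j) mxE; apply/eqP; rewrite floor_eq intrD.
have [iJ|iJ] := boolP (i \in J).
  rewrite XJ// mxE gE// hJ//.
  have := qJ i iJ; rewrite /q mxE YJ// !mxE => ?; lra.
have := XY _ qJ q01 i iJ; have := ce i; rewrite ltr_norml XE.
move: (X *m invmx Y *m q) (X *m (g - h)) => u v.
by rewrite !mxE (negbTE iJ); lra.
Qed.

End cells.

Section cell_dimensions.
Variables (R : realType) (d : nat) (J : {set 'I_d}).
Implicit Types (A B : 'M[R]_d) (v : R).

(* The matrix [A' A^-1], where [A'] is the rounding of [A] blown up by [v] off [J]. *)
Definition cell_mx v A : 'M[R]_d := map_mx intr (int_approx J v A) *m invmx A.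

Lemma cell_mx_fixes v A : v != 0 -> A \in unitmx ->
  (forall j k, j \in J -> A j k \is a Num.int) -> fixes_coords J (cell_mx v A).
Proof.
move=> v0 Au AJ x j jJ; rewrite /cell_mx rat_approxK// -2!mulmxA scale_mulE jJ mul1r.
rewrite -[in RHS](mulKVmx Au x) !mxE; apply: eq_bigr => k _.
by rewrite rat_approx_int_row// AJ.
Qed.

Lemma cell_mx_unit v A : A \in unitmx -> \det (int_approx J v A) != 0 ->
  cell_mx v A \in unitmx.
Proof.
move=> Au A0; rewrite unitmx_mul unitmx_inv Au andbT.
by rewrite unitmxE det_map_mx unitfE intr_eq0.
Qed.

(** With [w = t * v], the map from cells to slots acts off [J], on vectors that vanish on [J], as
    [t] times a matrix close to the identity. A cell becomes nearly a cube of side [t], and 1 - t is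
    the spare room. *)
Lemma cell_mx_exists A B : A \in unitmx -> B \in unitmx ->
  (forall j k, j \in J -> A j k \is a Num.int) ->
  (forall j k, j \in J -> B j k \is a Num.int) ->
  `|\det A| < `|\det B| ->
  exists v w e, [/\ v != 0, w != 0, 0 < e,
    \det (int_approx J v A) != 0 /\
    (`|\det (int_approx J v A)| <= `|\det (int_approx J w B)|)%N &
    forall q : 'cV[R]_d, (forall j, j \in J -> q j 0 = 0) ->
      (forall i, 0 <= q i 0 < 1) ->
      forall i, i \notin J ->
        - e < (cell_mx w B *m invmx (cell_mx v A) *m q) i 0 < 1 - 3 * e].
Proof.
move=> Au Bu AJ BJ AB.
have [t /andP[t0 t1] tP] := int_approx_exists Au Bu AJ BJ AB.
(* Chosen so that t (1 + e) < t + e = 1 - 3e. *)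
pose e : R := (1 - t) / 4; have e0 : 0 < e by rewrite divr_gt0// subr_gt0.
(* The [d] entries of a row then contribute at most [e] in total; [d.+1] keeps the divisor
   nonzero. *)
have [v [v0 A0 leAB Se]] := tP _ (divr_gt0 e0 (ltr0Sn R d)).
have vn0 : v != 0 by rewrite gt_eqF.
have wn0 : t * v != 0 by rewrite mulf_neq0// gt_eqF.
exists v, (t * v), e; split => // q qJ q01 i iJ.
set KA := rat_approx J v A in Se; set KB := rat_approx J (t * v) B in Se.
have KAu : KA \in unitmx.
  have : (map_mx intr (int_approx J v A) : 'M[R]_d) \in unitmx.
    by rewrite unitmxE det_map_mx unitfE intr_eq0.
  by rewrite rat_approxK// unitmx_mul => /andP[].
(* On vectors that vanish on [J], [scale v] is multiplication by [v]. *)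
have Yq : invmx (cell_mx v A) *m q = A *m (invmx KA *m (v^-1 *: q)).
  have qE : q = cell_mx v A *m (A *m (invmx KA *m (v^-1 *: q))).
    rewrite /cell_mx -mulmxA mulKmx// rat_approxK// -/KA -mulmxA mulKVmx//.
    apply/matrixP => a b; rewrite (ord1 b) scale_mulE mxE.
    by case: ifPn => [/qJ ->|_]; rewrite ?mulr0// mulVKf.
  by rewrite {1}qE mulKmx// cell_mx_unit.
rewrite -mulmxA Yq /cell_mx rat_approxK// -/KB -!mulmxA scale_mulE (negbTE iJ).
rewrite -!scalemxAr mxE mulrA mulfK// !mulmxA.
set S := _ *m _ in Se *.
have Sq : `|(S *m q) i 0 - q i 0| <= e.
  have -> : (S *m q) i 0 - q i 0 = \sum_k (S i k - (i == k)%:R) * q k 0.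
    rewrite mxE; under [RHS]eq_bigr do rewrite mulrBl.
    rewrite sumrB; congr (_ - _); rewrite (bigD1 i)//= eqxx mul1r big1 ?addr0// => k ki.
    by rewrite eq_sym (negbTE ki) mul0r.
  rewrite (le_trans (ler_norm_sum _ _ _))//.
  apply: (@le_trans _ _ (\sum_(k < d) e / d.+1%:R)).
    apply: ler_sum => k _; rewrite normrM -[leRHS]mulr1 ler_pM// ?(ltW (Se _ _))//.
    by have /andP[q0 q1] := q01 k; rewrite ger0_norm// ltW.
  rewrite sumr_const card_ord -[leLHS]mulr_natr -mulrA ler_piMr// ?(ltW e0)//.
  by rewrite mulrC ler_pdivrMr// mul1r ler_nat.
have := q01 i; move: Sq; rewrite ler_norml; move: (q i 0) ((S *m q) i 0) => a b.
move=> /andP[ab ba] /andP[a0 a1]; have te : 4 * e = 1 - t by rewrite /e; field.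
have te_lt : t * e < e by rewrite -[ltRHS]mul1r ltr_pM2r.
have ta0 : 0 <= t * a by rewrite mulr_ge0// ltW.
have ta1 : t * a <= t by rewrite ler_piMr// ltW.
have := ler_wpM2l (ltW t0) ab; have := ler_wpM2l (ltW t0) ba.
by rewrite mulrN mulrBr; lra.
Qed.

End cell_dimensions.

(** * The set built from the moved cells *)

Lemma int_mulmx_inj d (A : 'M[int]_d) (w : 'cV[int]_d) :
  \det A != 0 -> A *m w = 0 -> w = 0.
Proof.
move=> A0 /(congr1 (mulmx (\adj A))); rewrite mulmxA mul_adj_mx mul_scalar_mx mulmx0.
move=> /matrixP w0; apply/matrixP => i j.
by have /eqP := w0 i j; rewrite !mxE mulf_eq0 (negbTE A0) => /eqP.
Qed.

Section common_domain.
Variables (R : realType) (d : nat).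
Implicit Types (A B P X Y : 'M[R]_d) (J : {set 'I_d}) (x : 'cV[R]_d).

(** The label of the cell of [x]; because of [floor_on], a fibre is a flat cell thickened by [0, 1[
    in the [J]-coordinates. *)
Definition cell J P Y x : 'cV[int]_d :=
  map_mx Num.floor (Y *m floor_on J (invmx P *m x)).

(** Labels modulo [Z] are thus invariant under the lattice of [A], and this turns questions about
    lattice translates into questions about integer cosets. *)
Lemma cellD J P Y (Z : 'M[int]_d) A (z : 'cV[int]_d) x :
  Y *m invmx P *m A = map_mx intr Z ->
  integral_on J (invmx P *m (A *m map_mx intr z)) ->
  cell J P Y (x + A *m map_mx intr z) = cell J P Y x + Z *m z.
Proof.
move=> YZ zJ; rewrite /cell mulmxDr floor_onD// mulmxDr !mulmxA YZ -map_mxM.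
apply/matrixP => i j; move: (Y *m _) (Z *m z) => a b; rewrite !mxE.
by rewrite floorDrz ?intr_int// intrKfloor.
Qed.

(** Each of the two floors moves a point by at most 1, and [P] and [invmx Y] are bounded maps. *)
Lemma cell_bounded J P Y r : P \in unitmx -> Y \in unitmx ->
  exists c, forall x, cell J P Y x = r -> `|x| <= c.
Proof.
move=> Pu Yu; have [cP cP0 HP] := mulmx_norm_bound P.
have [cY cY0 HY] := mulmx_norm_bound (invmx Y).
exists (cP * (1 + cY * (1 + `|map_mx intr r : 'cV[R]_d|))) => x xr.
rewrite -[x](mulKVmx Pu); apply: le_trans (HP _) _; rewrite ler_pM2l//.
set y := invmx P *m x in xr *.
have frac01 (u : 'cV[R]_d) : (forall i, 0 <= u i 0 < 1) -> `|u| <= 1.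
  move=> u01; apply: norm_le_entries => // i.
  by have /andP[u0 u1] := u01 i; rewrite ger0_norm// ltW.
have floor_on_near (u : 'cV[R]_d) : `|u - floor_on J u| <= 1.
  apply: frac01 => i; rewrite !mxE; case: ifPn => _; last by rewrite subrr lexx ltr01.
  by have := floor_itv (u i 0); rewrite intrD; lra.
rewrite -[y](subrK (floor_on J y)) (le_trans (ler_normD _ _))// lerD//.
rewrite -[floor_on J y](mulKmx Yu); apply: le_trans (HY _) _; rewrite ler_pM2l//.
rewrite -[Y *m _](subrK (map_mx intr r)) (le_trans (ler_normD _ _))// lerD//.
by apply: frac01; exact: floor_frac.
Qed.

Lemma lattice_of_col A i : lattice_of A (col i A).
Proof. by exists (delta_mx i 0) => //=; rewrite map_delta_mx colE. Qed.

Theorem lattice_tiling_packing A B : A \in unitmx -> B \in unitmx ->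
  `|\det A| < `|\det B| ->
  exists F : set 'cV[R]_d, [/\ bounded_set F,
    measurable (F : set (lebesgue_space R d)),
    forall x, exists t, [/\ lattice_of A t, F (x + t) &
      forall t', lattice_of A t' -> F (x + t') -> t' = t] &
    forall x t t', lattice_of B t -> lattice_of B t' ->
      F (x + t) -> F (x + t') -> t = t'].
Proof.
move=> Au Bu AB.
pose G := [set g | exists z w : 'cV[int]_d,
  g = A *m map_mx intr z + B *m map_mx intr w].
have sG : subgroup G.
  split; first by exists 0, 0; rewrite !map_mx0 !mulmx0 addr0.
  move=> _ _ [z [w ->]] [z' [w' ->]]; exists (z - z'), (w - w').
  by rewrite !map_mxB !mulmxBr opprD addrACA.
have GA (z : 'cV[int]_d) : G (A *m map_mx intr z).
  by exists z, 0; rewrite map_mx0 mulmx0 addr0.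
have GB (w : 'cV[int]_d) : G (B *m map_mx intr w).
  by exists 0, w; rewrite map_mx0 mulmx0 add0r.
have [|P [J [Pu GJ Gdense]]] := subgroup_density sG Au.
  by move=> i; have [z _ <-] := lattice_of_col A i; exact: GA.
have rowJ C : (forall i, G (col i C)) ->
    forall j k, j \in J -> (invmx P *m C) j k \is a Num.int.
  by move=> GC j k jJ; have := GJ _ (GC k) j jJ; rewrite -col_mulmx mxE.
have AJ : forall j k, j \in J -> (invmx P *m A) j k \is a Num.int.
  by apply: rowJ => i; have [z _ <-] := lattice_of_col A i; exact: GA.
have BJ : forall j k, j \in J -> (invmx P *m B) j k \is a Num.int.
  by apply: rowJ => i; have [z _ <-] := lattice_of_col B i; exact: GB.
have PAu : invmx P *m A \in unitmx by rewrite unitmx_mul unitmx_inv Pu.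
have PBu : invmx P *m B \in unitmx by rewrite unitmx_mul unitmx_inv Pu.
have PAB : `|\det (invmx P *m A)| < `|\det (invmx P *m B)|.
  rewrite !det_mulmx !normrM ltr_pM2l// normr_gt0 -unitfE -unitmxE.
  by rewrite unitmx_inv.
have [v [w [e [v0 w0 e0 [ZA0 leAB] fit]]]] := cell_mx_exists PAu PBu AJ BJ PAB.
set ZA := int_approx J v _ in ZA0 leAB; set ZB := int_approx J w _ in leAB.
have ZB0 : \det ZB != 0.
  by rewrite -absz_gt0 (leq_trans _ leAB)// absz_gt0.
pose Y := cell_mx J v (invmx P *m A); pose X := cell_mx J w (invmx P *m B).
have Yu : Y \in unitmx by exact: cell_mx_unit.
have Xu : X \in unitmx by exact: cell_mx_unit.
have YA : Y *m invmx P *m A = map_mx intr ZA by rewrite -mulmxA mulmxKV.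
have XB : X *m invmx P *m B = map_mx intr ZB by rewrite -mulmxA mulmxKV.
have phiD x z : cell J P Y (x + A *m map_mx intr z) = cell J P Y x + ZA *m z.
  by apply: cellD => //; apply: GJ; exact: GA.
have psiD x z : cell J P X (x + B *m map_mx intr z) = cell J P X x + ZB *m z.
  by apply: cellD => //; apply: GJ; exact: GB.
have [T [rep [cardT rep_ex rep_inj]]] := int_matrix_transversal ZA0.
have [T' [rep' [cardT' _ rep'_inj]]] := int_matrix_transversal ZB0.
have leT : (#|T| <= #|T'|)%N by rewrite cardT cardT'.
(* The assignment of distinct slots to the cells. *)
pose s (c : T) : T' := enum_val (widen_ord leT (enum_rank c)).
have s_inj : injective s.
  move=> c c' /enum_val_inj/(congr1 val)/= cc'.
  by apply: enum_rank_inj; exact: val_inj.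
(* By density the move of the cell is taken in the sum of the lattices; [zw] records its two
   components. *)
have /choice[zw zwP] (c : T) : exists zw : 'cV[int]_d * 'cV[int]_d,
    forall x, cell J P Y x = rep c ->
      cell J P X (x + (A *m map_mx intr zw.1 + B *m map_mx intr zw.2)) = rep' (s c).
  have [h hJ [t t0 ht]] := cell_transport (rep c) (rep' (s c)) e0 Xu Yu
    (cell_mx_fixes w0 PBu BJ) (cell_mx_fixes v0 PAu AJ) fit.
  have [_ [z [z' ->]] gh] := Gdense _ hJ _ t0; exists (z, z') => x /= xc.
  have gJ : integral_on J (invmx P *m (A *m map_mx intr z + B *m map_mx intr z')).
    by apply: GJ; exists z, z'.
  rewrite /cell mulmxDr floor_onD//; apply: ht => //.
  exact: integral_floor_on.
(* Only the component along [A] is carried out. *)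
pose S c := [set x | cell J P Y (x - A *m map_mx intr (zw c).1) = rep c].
pose F := \bigcup_(c in [set: T]) S c.
(* The omitted component along [B], like the translation by [u], changes the slot label only by the
   image of [ZB]. *)
have F_pack x u c :
    cell J P Y (x + B *m map_mx intr u - A *m map_mx intr (zw c).1) = rep c ->
    cell J P X x + ZB *m (u + (zw c).2) = rep' (s c).
  by move=> /zwP; rewrite addrA subrK -addrA -mulmxDr -map_mxD psiD.
exists F; split.
- have /choice[b bP] c : exists b, forall x, S c x -> `|x| <= b.
    have [b bP] := cell_bounded J (rep c) Pu Yu.
    exists (b + `|A *m map_mx intr (zw c).1|) => x /bP.
    by move=> xb; rewrite -lerBlDr (le_trans (lerB_dist _ _)).
  exists (\sum_c `|b c|); split; first exact: num_real.
  move=> m bm x [c _ /bP xc].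
  rewrite /= (le_trans xc)// (le_trans (ler_norm _))// (le_trans _ (ltW bm))//.
  by rewrite (bigD1 c)//= lerDl sumr_ge0.
- apply: fin_bigcup_measurable => [|c _]; first exact: finite_finset.
  apply: (measurable_floor_fiber (f := fun x => Y *m floor_on J (invmx P *m (x - _)))).
  apply: measurable_map_mulmx; apply: measurable_map_floor_on.
  by apply: measurable_map_mulmx; apply: measurable_map_subr; exact: measurable_map_id.
(* The label of [x] modulo [ZA] selects [c]; injectivity of [ZA] then determines the translation. *)
- move=> x; have [c [z xz]] := rep_ex (cell J P Y x).
  exists (A *m map_mx intr ((zw c).1 - z)); split; first by exists ((zw c).1 - z).
    exists c => //; rewrite /S/= -addrA -mulmxBr -map_mxB addrAC subrr add0r.
    by rewrite phiD xz mulmxN addrK.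
  move=> _ [z' _ <-] [c' _ /=]; rewrite /S/= -addrA -mulmxBr -map_mxB phiD xz => xz'.
  have cc' : c' = c.
    apply: (rep_inj _ _ (z + (z' - (zw c').1))).
    by rewrite -xz' mulmxDr -[X in X - _]addrA [LHS]addrC addKr.
  move: xz'; rewrite cc' -addrA -mulmxDr => /(congr1 (+%R (- rep c))).
  rewrite addKr addNr => /(int_mulmx_inj ZA0) zz'; congr (_ *m map_mx _ _).
  by apply/eqP; rewrite -subr_eq0 opprB addrCA zz'.
(* Both slot labels agree with that of [x] modulo [ZB], so the slots, hence the cells, coincide;
   injectivity of [ZB] gives [u = u']. *)
- move=> x _ _ [u _ <-] [u' _ <-] [c _ /F_pack xc] [c' _ /F_pack xc'].
  have cc' : c = c'.
    apply: s_inj; apply: (rep'_inj _ _ ((u + (zw c).2) - (u' + (zw c').2))).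
    by rewrite -xc -xc' mulmxBr opprD addrACA subrr add0r.
  move: xc'; rewrite -cc' -xc => /addrI/eqP; rewrite -subr_eq0 -mulmxBr => /eqP.
  move=> /(int_mulmx_inj ZB0)/eqP; rewrite subr_eq0 => /eqP/addIr ->//.
Qed.

End common_domain.

(** * From unique translates to multiplicities *)

Lemma multiplicity_set1 (R : realType) d (F T : set 'cV[R]_d) x t :
  T t -> F (x + t) -> (forall t', T t' -> F (x + t') -> t' = t) ->
  multiplicity F T x = 1%E.
Proof.
move=> Tt Ft uniq; rewrite /multiplicity esum_mkcond.
rewrite (eq_esum (b := fun t' => if t' \in [set t] then 1%E else 0%E)) => [|t' _].
  by rewrite -esum_mkcond esum_set1// lee01.
rewrite indicE; case: ifPn => [/set_mem Tt'|]; last first.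
  by case: ifPn => // /set_mem -> /negP[]; exact/mem_set.
case: ifPn => [/set_mem ->|/negP tt']; first by rewrite mem_set.
by rewrite memNset// => Ft'; apply: tt'; apply/mem_set; exact: uniq.
Qed.

Theorem theorem1p2 (R : realType) (d : nat) (L M : set 'cV[R]_d)
    (latL : lattice L) (rankL : full_rank L)
    (latM : lattice M) (rankM : full_rank M)
    (volLM : vol L < vol M) :
  exists F : set 'cV[R]_d,
    [/\ bounded_set F, measurable (F : set (lebesgue_space R d)),
        tiles F L & packs F M].
Proof.
have [A [Au LA volA]] := vol_basis latL rankL.
have [B [Bu MB volB]] := vol_basis latM rankM.
have [|F [bF mF tF pF]] := lattice_tiling_packing Au Bu; first by rewrite -volA -volB.
(* Tiling and packing hold at every point, not only almost everywhere. *)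
exists F; split => //; apply: aeW => x.
  have [t [At Ft tuniq]] := tF x.
  by rewrite LA; exact: multiplicity_set1 At Ft tuniq.
have [[t Mt Ft]|noF] := pselect (exists2 t, M t & F (x + t)).
  rewrite (multiplicity_set1 Mt Ft)// => t' Mt' Ft'.
  by rewrite MB in Mt Mt'; exact: pF Mt' Mt Ft' Ft.
rewrite /multiplicity esum1 ?lee01// => t Mt; rewrite indicE memNset// => Ft.
by apply: noF; exists t.
Qed.
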